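(* Let $q\ge5$ be an odd prime power, $m=2t+1\ge5$, and $n=\frac{q^m+1}{q+1}$. For an integer $\delta$ put $\epsilon=\lceil(\delta-1)(1-q^{-1})\rceil$, and let $A=\frac{q^{t+1}+2q^t+1}{q+1}$, $B=2\frac{q^{t+1}-1}{q+1}-1$ if $t$ is odd, and $A=\frac{q^{t+1}+2q^t-1}{q+1}$, $B=2\frac{q^{t+1}+1}{q+1}-1$ if $t$ is even. Then the LCD BCH code $\mathcal{C}_{(n,q,\delta,1)}$ has parameters $[n,k,d\ge\delta]$ and $\mathcal{C}_{(n,q,\delta+1,0)}$ has parameters $[n,k-1,d\ge2\delta]$, where $k=n-2m(\epsilon-1)$ if $q^t+2\le\delta\le A$, and $k=n-2m(\epsilon-2)$ if $A+1\le\delta\le B$.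
   Context: Let $q$ be a prime power and $n\ge2$ an integer with $\gcd(n,q)=1$. Let $\ell=\mathrm{ord}_n(q)$, let $\alpha$ be a generator of $\mathbb{F}_{q^\ell}^*$, $\beta=\alpha^{(q^\ell-1)/n}$, and let $m_i(x)$ be the minimal polynomial of $\beta^i$ over $\mathbb{F}_q$. For integers $b\ge0$ and $2\le\delta\le n$, $\mathcal{C}_{(n,q,\delta,b)}$ denotes the cyclic (BCH) code of length $n$ over $\mathbb{F}_q$ with generator polynomial $\mathrm{lcm}(m_b(x),\dots,m_{b+\delta-2}(x))$. A linear code $\mathcal{C}$ is LCD if $\mathcal{C}\cap\mathcal{C}^\perp=\{0\}$ (Euclidean dual). $[n,k,d\ge D]$ means length $n$, dimension $k$, minimum Hamming distance at least $D$. *)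

(* Defs.v *)
From HB Require Import structures.
From mathcomp Require Import all_boot all_order all_algebra all_field.
Set Implicit Arguments. Unset Strict Implicit. Unset Printing Implicit Defensive.
Import GRing.Theory.
Local Open Scope ring_scope.

Section Codes.
Variable F : finFieldType.

Definition is_minpoly_over (L : fieldExtType F) (x : L) (p : {poly F}) : Prop :=
  [/\ p \is monic, root (map_poly (in_alg L) p) x &
      forall r : {poly F}, r != 0 -> root (map_poly (in_alg L) r) x ->
        (size p <= size r)%N].

(* least common multiple of polynomials (up to associates) *)
Definition lcm_poly (p r : {poly F}) : {poly F} := (p * r) %/ gcdp p r.

Definition bch_gen (mp : nat -> {poly F}) (delta b : nat) : {poly F} :=
  \big[lcm_poly/1]_(b <= i < b + delta.-1) mp i.

Definition cyclic_code (n : nat) (g : {poly F}) : {set 'rV[F]_n} :=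
  [set c | g %| rVpoly c].

Definition bch_code (n : nat) (mp : nat -> {poly F}) (delta b : nat)
  : {set 'rV[F]_n} := cyclic_code n (bch_gen mp delta b).

Definition code_dim (n : nat) (C : {set 'rV[F]_n}) : nat :=
  \dim (span (enum C)).

Definition wt (n : nat) (c : 'rV[F]_n) : nat := #|[set i | c 0 i != 0]|.

Definition min_dist_ge (n : nat) (C : {set 'rV[F]_n}) (D : nat) : Prop :=
  forall c, c \in C -> c != 0 -> (D <= wt c)%N.

Definition dual_code (n : nat) (C : {set 'rV[F]_n}) : {set 'rV[F]_n} :=
  [set v | [forall c in C, v *m c^T == 0]].

Definition is_LCD (n : nat) (C : {set 'rV[F]_n}) : Prop :=
  C :&: dual_code C = [set 0].

End Codes.

Local Open Scope nat_scope.
(* numerical parameters (nat arithmetic; all divisions are exact) *)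
Definition len_n (q t : nat) : nat := (q ^ t.*2.+1 + 1) %/ (q + 1).
(* epsilon = ceil((delta-1)(1 - 1/q)) = ceil((delta-1)(q-1)/q) *)
Definition eps (q delta : nat) : nat := ((delta - 1) * (q - 1) + (q - 1)) %/ q.
Definition boundA (q t : nat) : nat :=
  if odd t then (q ^ t.+1 + 2 * q ^ t + 1) %/ (q + 1)
  else (q ^ t.+1 + 2 * q ^ t - 1) %/ (q + 1).
Definition boundB (q t : nat) : nat :=
  if odd t then 2 * ((q ^ t.+1 - 1) %/ (q + 1)) - 1
  else 2 * ((q ^ t.+1 + 1) %/ (q + 1)) - 1.

(* Main.v *)
(** Write m = 2t+1. Since n divides q^m + 1, the set of zeros of either code is
    stable under j |-> -j. Hence a codeword c of C meeting its dual satisfies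
    c * c = 0 for cyclic convolution, so every c(beta^j) vanishes and c = 0;
    moreover C_(delta+1,0) has the 2 delta - 1 consecutive zeros
    -(delta-1), ..., delta-1, so the BCH bound gives 2 delta.

    For the dimension, count the q-cyclotomic cosets meeting {1, ..., delta-1}.
    Up to sign, a collision i q^s = j mod n may be taken with s <= t, and then
    i q^s -+ j = r n with r <= 1. For r = 0 it is trivial; r = 1 forces s = t.
    Put u = (q^(t+1) +- 1)/(q+1) and v = (q^t -+ 1)/(q+1) (upper signs for t
    even), so that q^t = u + v, n = u q^t -+ v, A = u + 2v and B = 2u - 1. The
    remaining equation leaves only u q^t = +-v and (u +- 1) q^t = +-A. Apart
    from these, the non-multiples of q in the range lie in distinct cosets of
    size 2m, so v, and also A when A < delta, are the only indices to discard. *)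

Require Import Defs.
From HB Require Import structures.
From mathcomp Require Import all_boot all_order all_algebra all_field.
From mathcomp Require Import zify.
Import GRing.Theory.
Local Open Scope ring_scope.
Set Implicit Arguments.
Unset Strict Implicit.

(** * Arithmetic of n, A, B and epsilon, and cyclotomic cosets modulo n *)

Section Arithmetic.
Local Open Scope nat_scope.

(** This is v = (q^t - (-1)^t)/(q+1), written without subtraction. *)
Definition alt_quotient (q t v : nat) : Prop :=
  if odd t then q ^ t + 1 = q.+1 * v else q ^ t = q.+1 * v + 1.

Lemma alt_quotient_exists (q t : nat) : 0 < q -> exists v, alt_quotient q t v.
Proof.
move=> q0; elim: t => [|t [v]]; rewrite /alt_quotient /=.
  by exists 0; rewrite muln0.
case: (odd t) => /= Hv; last first.
  by exists (q * v + 1); rewrite expnS Hv; lia.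
have v0 : 0 < v by case: v Hv => //; lia.
by exists (q * v - 1); rewrite expnS; nia.
Qed.

(** The first alternative is t even, the second t odd. With u q^t written as u(u+v), most later
    estimates are linear in u, v, q v and this one product. *)
Definition bch_split (q t n u v : nat) : Prop :=
  [/\ 0 < v, q ^ t = u + v &
      u = q * v + 1 /\ n + v = u * (u + v) \/
      u + 1 = q * v /\ n = u * (u + v) + v].

Lemma bch_split_exists (q t : nat) : 5 <= q -> 2 <= t ->
  len_n q t * q.+1 = q ^ t.*2.+1 + 1 /\
  exists u v, [/\ bch_split q t (len_n q t) u v,
                  boundA q t = u + 2 * v & boundB q t = 2 * u - 1].
Proof.
move=> q5 t2; have [v] := @alt_quotient_exists q t (leq_trans (isT : 0 < 5) q5).
have Q1 : q ^ 2 <= q ^ t by rewrite leq_exp2l; lia.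
have E2 : q ^ t.*2.+1 = q * q ^ t * q ^ t by rewrite expnS -addnn expnD mulnA.
have E1 : q ^ t.+1 = q * q ^ t by rewrite expnS.
rewrite /bch_split /alt_quotient /len_n /boundA /boundB E1 E2.
have dE x y : x = y * (q + 1) -> x %/ (q + 1) = y.
  by move=> ->; rewrite mulnK // addn1.
case: (odd t) => Hv.
  have v0 : 0 < v by case: v Hv => //; lia.
  have u0 : 0 < q * v by nia.
  rewrite (dE _ ((q * v - 1) * q ^ t + v)); last nia.
  rewrite (dE (q * q ^ t - 1) (q * v - 1)); last nia.
  rewrite (dE _ ((q + 2) * v - 1)); last nia.
  split; first by nia.
  exists (q * v - 1), v.
  have -> : q ^ t = q * v - 1 + v by lia.
  by split; [split=> //; right; split| |]; lia.
have v0 : 0 < v by case: v Hv => //; lia.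
have vle : v <= (q * v + 1) * q ^ t by nia.
rewrite (dE _ ((q * v + 1) * q ^ t - v)); last nia.
rewrite (dE (q * q ^ t + 1) (q * v + 1)); last nia.
rewrite (dE _ ((q + 2) * v + 1)); last nia.
split; first by nia.
exists (q * v + 1), v.
have Qe : q ^ t = q * v + 1 + v by lia.
rewrite Qe in vle *.
by split; [split=> //; left; split| |]; lia.
Qed.

(** The ceiling equals (d-1) - floor((d-1)/q), and the floor counts the multiples of q among 1, ...,
    d-1. *)
Lemma eps_count q d : 1 < q -> 0 < d ->
  eps q d = \sum_(0 <= i < d | 0 < i) ~~ (q %| i).
Proof.
case: d => // d q1 _; have q0 : 0 < q by apply: ltnW.
have -> : eps q d.+1 = d - d %/ q.
  rewrite /eps subn1 /= {1 2}(divn_eq d q).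
  have := ltn_pmod d q0; move: (d %/ q) (d %% q) => a b bq.
  have -> : (a * q + b) * (q - 1) + (q - 1) = (a * (q - 1) + b) * q + (q - 1 - b) by nia.
  rewrite divnMDl // divn_small; last by lia.
  by nia.
elim: d => [|d IH]; first by rewrite big_mkcond big_nat1 /= div0n.
rewrite big_mkcond big_nat_recr //= -big_mkcond /= -IH divnS //.
by have := leq_div d q; case: (q %| d.+1) => /=; lia.
Qed.

Lemma ndvdn_add (q w d : nat) : 0 < d < q -> ~~ (q %| q * w + d).
Proof. by case/andP=> d0 dq; rewrite dvdn_addr ?dvdn_mulr // gtnNdvd. Qed.

(** * Collisions i q^s = j and i q^s = -j modulo n *)

Section Collisions.
Variables (q t n u v : nat).
Hypotheses (q5 : 5 <= q) (t2 : 2 <= t) (suv : bch_split q t n u v).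

(** As delta <= B = 2u - 1, indices below delta are at most 2u - 2. Multiples of q are left out
    because i and q i share a coset. *)
Definition in_range i := [&& 0 < i, i + 2 <= 2 * u & ~~ (q %| i)].
(* For v and A = u + 2v the coset is already met by u and by u + 1 or u - 1. *)
Definition redundant i := (i == v) || (i == u + 2 * v).

Lemma le_5v_qv : 5 * v <= q * v.
Proof. by rewrite leq_mul2r q5 orbT. Qed.

Lemma le_20u_uQ : 20 * u <= u * (u + v).
Proof.
case: suv => v0 Q _; rewrite [20 * u]mulnC leq_mul2l -Q; apply/orP; right.
apply: (@leq_trans (5 ^ 2)) => //; apply: leq_trans (leq_pexp2l _ t2); last by lia.
by rewrite leq_exp2r.
Qed.

(** u is 1 or -1 modulo q. *)
Lemma ndvd_u : ~~ (q %| u).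
Proof.
case: (suv) => v0 _; have qqv : q <= q * v by rewrite leq_pmulr.
case=> [[-> _]|[uE _]]; first by apply: ndvdn_add; clear -q5; lia.
have -> : u = q * (v - 1) + (q - 1) by rewrite mulnBr -uE; clear -q5 uE qqv; lia.
by apply: ndvdn_add; clear -q5; lia.
Qed.

Lemma ndvd_v : ~~ (q %| v).
Proof.
have := ndvd_u; case: suv => v0 Q _; apply: contra => qv.
by rewrite -(dvdn_addl u qv) -Q -(ltn_predK t2) expnS dvdn_mulr.
Qed.

Lemma ndvd_u2v : ~~ (q %| u + 2 * v).
Proof.
have := ndvd_v; case: suv => v0 Q _.
by rewrite mul2n -addnn addnA -Q dvdn_addr // -(ltn_predK t2) expnS dvdn_mulr.
Qed.

Lemma range_sum_lt i j : i + 2 <= 2 * u -> j + 2 <= 2 * u -> i + j < n.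
Proof.
have := le_20u_uQ; have := le_5v_qv.
case: suv => v0 _ [[uE nE]|[uE nE]]; lia.
Qed.

(** Since n = u q^t -+ v and j < 2u, i is within 1 of u. Then i = u gives j = v; of u + 1 and u - 1,
    one is q v and the other gives j = u + 2v. *)
Lemma collision_top i j : i + 2 <= 2 * u -> j + 2 <= 2 * u -> 0 < j ->
  i * (u + v) + j = n \/ i * (u + v) = n + j ->
  [\/ q %| i, j = v | j = u + 2 * v].
Proof.
move=> iu ju j0 H; case: (suv) => v0 Q cs.
have dv (w : nat) : i = q * w -> q %| i by move=> ->; rewrite dvdn_mulr.
have hi (x y : nat) : x <= y -> x * (u + v) <= y * (u + v).
  by rewrite leq_mul2r => ->; rewrite orbT.
have q5v := le_5v_qv.
have [iE|iE|iE|iE] : [\/ i = u, i = u + 1, i + 1 = u | u + 2 <= i \/ i + 2 <= u].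
- case: (ltngtP i u) => [lt|gt|E]; last by apply: Or41.
    by case: (ltngtP i.+1 u) => ?; [apply: Or44|lia|apply: Or43]; lia.
  by case: (ltngtP u.+1 i) => ?; [apply: Or44|lia|apply: Or42]; lia.
- by rewrite iE in H; case: cs => [[uE nE]|[uE nE]]; apply: Or32; lia.
- rewrite iE mulnDl mul1n in H.
  case: cs => [[uE nE]|[uE nE]]; first by apply: Or33; lia.
  by apply: Or31; apply: (dv v); lia.
- have uv : i * (u + v) + (u + v) = u * (u + v) by rewrite -iE mulnDl mul1n.
  case: cs => [[uE nE]|[uE nE]]; last by apply: Or33; lia.
  by apply: Or31; apply: (dv v); lia.
(* Here i q^t differs from n by at least 2 q^t - v = 2u + v, which exceeds j. *)
- exfalso; case: iE => /hi; rewrite mulnDl => iE;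
  case: cs => [[uE nE]|[uE nE]]; lia.
Qed.

(** Both signs are treated at once; the last conjunct then rules out the minus sign for
    non-redundant indices. *)
Lemma collision_half s i j : s <= t -> in_range i -> in_range j ->
  (n %| i * q ^ s + j) \/ (i * q ^ s = j %[mod n]) ->
  redundant i || redundant j \/
  [/\ s = 0, i = j & ~~ (n %| i * q ^ s + j)].
Proof.
move=> st /and3P[i0 iu iq] /and3P[j0 ju jq] H.
case: (suv) => v0 Q cs; have q5v := le_5v_qv; have u20 := le_20u_uQ.
have jn : j < n by apply: leq_ltn_trans (leq_addl i j) (range_sum_lt iu ju).
have [r Hr] : exists r, i * q ^ s + j = r * n \/ i * q ^ s = r * n + j.
  case: H => [/dvdnP[r ->]|H]; first by exists r; left.
  exists (i * q ^ s %/ n); right.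
  by rewrite {1}(divn_eq (i * q ^ s) n) H (modn_small jn).
have sQ : q ^ s <= q ^ t by rewrite leq_exp2l; lia.
have q0 : 0 < q ^ s by rewrite expn_gt0; lia.
(* The extreme case is (2u-2) q^t + (2u-2) = 2(u q^t - v - 1), just below 2n. *)
have r2 : r < 2.
  have : i * q ^ s + j < 2 * n.
    have : i * q ^ s <= i * (u + v) by rewrite leq_mul2l -Q sQ orbT.
    have : (i + 2) * (u + v) <= 2 * u * (u + v) by rewrite leq_mul2r iu orbT.
    clear H Hr sQ q0 jn.
    by case: cs => [[uE nE]|[uE nE]]; lia.
  move=> lt; rewrite ltnNge; apply/negP => r2.
  have : 2 * n <= r * n by rewrite leq_mul2r r2 orbT.
  by move: Hr lt; move: (r * n) (2 * n) (i * q ^ s) => a b c; clear; lia.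
have [s0|spos] := posnP s.
  rewrite s0 expn0 muln1 in Hr *.
  case: r r2 Hr => [|[|//]] _; rewrite ?mul0n ?mul1n => Hr.
    have ij : i = j by clear -Hr j0; lia.
    right; split=> //; rewrite gtnNdvd ?addn_gt0 ?i0 //.
    exact: range_sum_lt.
  have := range_sum_lt iu ju; rewrite ltnNge.
  by case: Hr => ->; rewrite ?leqnn // -addnA leq_addr.
case: r r2 Hr => [|[|//]] _; rewrite ?mul0n ?mul1n => Hr.
  case/negP: jq; have <- : i * q ^ s = j by clear -Hr j0; lia.
  by rewrite dvdn_mull // -(prednK spos) expnS dvdn_mulr.
(* If s < t then 5 q^s <= q^t, so i q^s is at most 2/5 of u q^t and r = 1 is out of reach. *)
have [st'|sE] : s < t \/ s = t by clear -st; lia.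
  exfalso; have : i * q ^ s + j < n; last by clear -Hr j0; lia.
  have h0 : 5 * q ^ s <= u + v.
    rewrite -Q; apply: leq_trans (leq_pexp2l _ st'); last by clear -q5; lia.
    by rewrite expnS leq_mul2r q5 orbT.
  have : i * (5 * q ^ s) <= 2 * u * (5 * q ^ s).
    by rewrite leq_mul2r; apply/orP; right; clear -iu; lia.
  move=> h1; have h2 := leq_mul (leqnn (2 * u)) h0.
  have : 5 * (i * q ^ s) <= 2 * (u * (u + v)).
    by rewrite mulnCA [2 * (_ * _)]mulnA; apply: leq_trans h2.
  move: u20; move: (u * (u + v)) (i * q ^ s) cs => W z cs u20 hz.
  clear -cs u20 hz ju q5v v0.
  by case: cs => [[uE nE]|[uE nE]]; lia.
rewrite sE Q in Hr.
left; rewrite /redundant.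
have [|iq'|->|->] := collision_top iu ju j0; rewrite ?eqxx ?orbT //.
by rewrite iq' in iq.
Qed.

Lemma pow_negation : n %| q ^ t.*2.+1 + 1 -> forall x, n %| x * q ^ t.*2.+1 + x.
Proof. by move=> nq x; rewrite -[X in _ + X]muln1 -mulnDr dvdn_mull. Qed.

Lemma collision s i j : n %| q ^ t.*2.+1 + 1 -> s < t.*2.+1.*2 ->
  in_range i -> in_range j -> i * q ^ s = j %[mod n] ->
  redundant i || redundant j \/ s = 0 /\ i = j.
Proof.
(* q^m = -1 reduces the exponent to s, m - s, s - m or 2m - s, each at most t. *)
move=> nq sm ri rj H; set m := t.*2.+1 in nq sm *.
have neg := pow_negation nq; rewrite -/m in neg.
have dD x y : x = y %[mod n] -> forall z, n %| x + z = (n %| y + z).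
  by move=> xy z; rewrite /dvdn -modnDml xy modnDml.
have scale d : i * q ^ (s + d) = j * q ^ d %[mod n].
  by rewrite expnD mulnA -modnMml H modnMml.
have [st|ts] := leqP s t.
  by case: (collision_half st ri rj (or_intror H)) => [?|[]]; [left|right].
have [sm1|ms] := leqP s m.
  have sd : m - s <= t by lia.
  have nd : n %| j * q ^ (m - s) + i by rewrite -(dD _ _ (scale _)) subnKC.
  case: (collision_half sd rj ri (or_introl nd)) => [rr|[_ _]].
    by rewrite orbC; left.
  by rewrite nd.
have [smt|mts] := leqP s (m + t).
  have sd : s - m <= t by lia.
  have nd : n %| i * q ^ (s - m) + j.
    rewrite addnC -(dD _ _ H) -{1}(subnK (ltnW ms)) expnD mulnA; exact: neg.
  case: (collision_half sd ri rj (or_introl nd)) => [rr|[_ _]]; first by left.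
  by rewrite nd.
have sd : m.*2 - s <= t by lia.
have E : j * q ^ (m.*2 - s) = i %[mod n].
  rewrite -scale subnKC; last exact: ltnW.
  apply/eqP; rewrite -(eqn_modDr (i * q ^ m)) [X in _ == X %[mod n]]addnC.
  by rewrite (eqP (neg _)) -addnn expnD mulnA; exact: neg.
case: (collision_half sd rj ri (or_intror E)) => [rr|[s0]].
  by rewrite orbC; left.
by move/eqP: s0; rewrite subn_eq0 leqNgt sm.
Qed.

(** * Counting the exponents covered by the cosets of 1, ..., delta-1 *)

Section Count.
Variable delta : nat.
Hypotheses (nq : n %| q ^ t.*2.+1 + 1) (du : u < delta) (d2 : delta < 2 * u).
Let M := t.*2.+1.*2.

(** A leader need not be the least element of its coset: u is kept and the smaller v is dropped. *)
Definition leaders : {set 'I_delta} :=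
  [set i : 'I_delta | [&& 0 < i, ~~ (q %| i) & ~~ redundant i]].

Lemma n_gt0 : 0 < n.
Proof. by have := nq; case: (n) => //; rewrite dvd0n addn1. Qed.

Lemma pow_period x : x * q ^ M = x %[mod n].
Proof.
apply/eqP; rewrite -(eqn_modDr (x * q ^ t.*2.+1)) [X in _ == X %[mod n]]addnC.
by rewrite (eqP (pow_negation nq _)) /M -addnn expnD mulnA; exact: pow_negation.
Qed.

Lemma pow_mod x s : x * q ^ s = x * q ^ (s %% M) %[mod n].
Proof.
rewrite {1}(divn_eq s M); elim: (s %/ M) => [|k IH] //.
by rewrite mulSn -addnA addnC expnD mulnA pow_period.
Qed.

Lemma neg_pow x y s : n %| x * q ^ s + y -> x * q ^ (s + t.*2.+1) = y %[mod n].
Proof.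
move=> xy; apply/eqP; rewrite -(eqn_modDr (x * q ^ s)) [X in _ == X %[mod n]]addnC.
by rewrite (eqP xy) expnD mulnA; exact: pow_negation.
Qed.

(** By strong induction a multiple of q is divided by q; a redundant index is traced back to u, u +
    1 or u - 1. *)
Lemma coset_leader_exists i : 0 < i < delta ->
  exists j : 'I_delta, j \in leaders /\ exists s, j * q ^ s = i %[mod n].
Proof.
elim/ltn_ind: i => i IH /andP[i0 id].
case/boolP: (q %| i) => [/dvdnP[k ik]|iq].
  have ki : k < i by rewrite ik; clear -i0 ik q5; nia.
  have [|j [jl [s js]]] := IH k ki.
    by rewrite (ltn_trans ki id) andbT; case: (k) ik i0 => // ->.
  exists j; split=> //; exists s.+1.
  by rewrite expnSr mulnA -modnMml js modnMml ik.
case: (suv) => v0 Q cs; have q5v := le_5v_qv.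
have qqv : q <= q * v by rewrite leq_pmulr.
(* Here k q^t is i or -i modulo n; a minus sign is absorbed by a further factor q^m = -1. *)
have ldr k : u <= k + 1 <= u + 2 -> ~~ (q %| k) -> k < delta ->
    k * (u + v) = n + i \/ k * (u + v) + i = n ->
    exists j : 'I_delta, j \in leaders /\ exists s, j * q ^ s = i %[mod n].
  move=> ku kq kd kH; exists (Ordinal kd); split; rewrite ?inE /=.
    rewrite kq /redundant negb_or -!(rwP andP) -!(rwP eqP) //=.
    clear kq kH; case: cs => [[uE nE]|[uE nE]]; lia.
  case: kH => kH; first by exists t; rewrite Q kH modnDl.
  by exists (t + t.*2.+1); apply: neg_pow; rewrite Q kH.
case/boolP: (redundant i) => [/orP[/eqP iE|/eqP iE]|ir]; last first.
- by exists (Ordinal id); rewrite inE i0 iq ir; split=> //; exists 0; rewrite muln1.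
- case: cs => [[uE nE]|[uE nE]].
    apply: (ldr (u + 1)); last (by left; lia); try by clear nE; lia.
    by rewrite uE -addnA; apply: ndvdn_add; clear -q5; lia.
  apply: (ldr (u - 1)); last first.
  + have : u + v <= u * (u + v) by rewrite leq_pmull //; clear -uE qqv q5; lia.
    by right; rewrite mulnBl mul1n iE nE; lia.
  + by clear nE; lia.
  + have -> : u - 1 = q * (v - 1) + (q - 2) by rewrite mulnBr muln1; clear -q5 uE qqv; lia.
    by apply: ndvdn_add; clear -q5; lia.
  + by clear nE; lia.
- apply: (ldr u) => //; [by clear; lia|exact: ndvd_u|].
  by rewrite iE; case: cs => [[_ nE]|[_ nE]]; clear -nE; [left|right]; lia.
Qed.

(** These are the exponents of the zeros of the code with b = 1. Exponents s < 2m suffice because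
    q^(2m) = 1 modulo n. *)
Definition cyclotomic_closure : {set 'I_n} :=
  [set j : 'I_n | [exists i : 'I_delta, (0 < i) &&
                   [exists s : 'I_M, i * q ^ s == j %[mod n]]]].

(** The map (i, s) -> i q^s on leaders times s < 2m is onto by [coset_leader_exists] and injective
    by [collision]. *)
Lemma card_cyclotomic_closure : #|cyclotomic_closure| = M * #|leaders|.
Proof.
pose f (x : 'I_delta * 'I_M) : 'I_n := Ordinal (ltn_pmod (x.1 * q ^ x.2) n_gt0).
have M0 : 0 < M by [].
have <- : f @: setX leaders setT = cyclotomic_closure.
  apply/setP=> j; rewrite inE; apply/imsetP/existsP.
    case=> [[i s]]; rewrite !inE /= andbT => /and3P[i0 _ _] ->.
    exists i; rewrite i0; apply/existsP; exists s.
    by rewrite /f /= modn_mod.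
  case=> i /andP[i0 /existsP[s /eqP iE]].
  have [|k [kl [s' ks]]] := @coset_leader_exists i; first by rewrite i0 /=.
  exists (k, Ordinal (ltn_pmod (s' + s) M0)); first by rewrite !inE andbT in kl *.
  apply: val_inj => /=; rewrite -pow_mod expnD mulnA -modnMml ks modnMml iE.
  by rewrite modn_small.
rewrite card_in_imset ?cardsX ?cardsT ?card_ord 1?mulnC // => -[i s] [j s'].
rewrite !inE !andbT /= => /and3P[i0 iq ir] /and3P[j0 jq jr] /(congr1 val) /= E.
wlog ss : i s j s' i0 iq ir j0 jq jr E / s' <= s => [th|].
  by case: (leqP s' s) => [|/ltnW] ss; [exact: th|symmetry; apply: th].
have rg (k : 'I_delta) : 0 < k -> ~~ (q %| k) -> in_range k.
  by move=> k0 kq; rewrite /in_range k0 kq andbT; have := ltn_ord k; clear -d2; lia.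
(* Multiply [E] by q^(2m - s') and drop full periods. *)
have E' : i * q ^ (s - s') = j %[mod n].
  have sM : s' <= M by apply: ltnW.
  rewrite -pow_period -mulnA -expnD addnBAC // -addnBA // expnD mulnA -modnMml E.
  by rewrite modnMml -mulnA -expnD subnKC // pow_period.
case: (collision nq _ (rg i i0 iq) (rg j j0 jq) E').
- exact: leq_ltn_trans (leq_subr _ _) (ltn_ord s).
- by rewrite (negPf ir) (negPf jr).
- case=> /eqP; rewrite subn_eq0 => ss' ij; congr pair; apply: val_inj => //=.
  by apply/eqP; rewrite eqn_leq ss ss'.
Qed.

(** Multiplication by q is invertible modulo n, and 0 < i < n. Hence the zero beta^0 of the second
    code is new and costs one dimension. *)
Lemma zero_notin_closure (j : 'I_n) : j = 0 :> nat -> j \notin cyclotomic_closure.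
Proof.
move=> j0; rewrite inE; apply/existsP=> -[i /andP[i0 /existsP[s /eqP is0]]].
have : i * q ^ M = 0 %[mod n].
  rewrite -(subnKC (ltnW (ltn_ord s))) expnD mulnA -modnMml is0 j0.
  by rewrite modnMml mul0n.
rewrite pow_period mod0n => /eqP/dvdn_leq; move/(_ i0); rewrite leqNgt.
have id := ltn_ord i.
by rewrite (leq_ltn_trans (leq_addr i i)) // range_sum_lt //; clear -id d2; lia.
Qed.

(** Among the [eps q delta] non-multiples of q, v < u < delta always drops out, and A = u + 2v only
    when in range: this separates the two dimension formulas. *)
Lemma card_leaders : #|leaders| = eps q delta - 1 - (u + 2 * v < delta).
Proof.
case: (suv) => v0 _ cs.
have vu : v < u.
  by have := le_5v_qv; clear -v0 cs; case: cs => [[uE _]|[uE _]]; lia.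
have vd := ltn_trans vu du.
pose N : {set 'I_delta} := [set i : 'I_delta | (0 < i) && ~~ (q %| i)].
have <- : #|N| = eps q delta.
  rewrite eps_count ?(leq_ltn_trans _ du) //; last exact: leq_trans q5.
  rewrite big_mkord -sum1_card big_mkcond [RHS]big_mkcond.
  by apply: eq_bigr => i _; rewrite inE; case: (0 < i); case: (q %| i).
rewrite (cardsD1 (Ordinal vd) N) inE /= v0 ndvd_v add1n subn1 /=.
have [Ad|Ad] := ltnP (u + 2 * v) delta; last first.
  rewrite subn0; apply: eq_card => i; rewrite !inE /redundant -val_eqE /= negb_or.
  have -> : (i == u + 2 * v :> nat) = false.
    by apply/negbTE; rewrite neq_ltn (leq_trans (ltn_ord i) Ad).
  by rewrite andbT; case: (0 < i); case: (q %| i); case: (i == v :> nat).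
have Av : u + 2 * v != v by clear -vu; lia.
rewrite (cardsD1 (Ordinal Ad) (N :\ _)) !inE -val_eqE /= Av ndvd_u2v addn_gt0.
rewrite (leq_ltn_trans _ vu) // add1n subn1 /=.
apply: eq_card => i; rewrite !inE /redundant -!val_eqE /= negb_or.
by case: (0 < i); case: (q %| i); case: (i == v :> nat); case: (i == _ :> nat).
Qed.

End Count.
End Collisions.
End Arithmetic.

(** * Frobenius on L and descent to F *)

Section Frobenius.
Variables (F : finFieldType) (L : fieldExtType F).
Local Notation q := #|F|.
Local Notation "p ^L" := (map_poly (in_alg L) p) (at level 2, format "p ^L").
Implicit Types (x y : L) (p : {poly F}).

Lemma frobeniusB x y : (x - y) ^+ q = x ^+ q - y ^+ q.
Proof.
have [r _ charFr] := finPcharP F; rewrite (card_pprimeChar charFr).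
elim: (logn _ _) => // n IHn; rewrite expnSr !exprM {}IHn.
by rewrite -(pchar_lalg L) in charFr; rewrite -pFrobenius_autE rmorphB.
Qed.

Lemma finField_card_gt0 : (0 < q)%N.
Proof. by apply/card_gt0P; exists 0. Qed.

Lemma expr0_card : 0 ^+ q = 0 :> L.
Proof. by rewrite expr0n eqn0Ngt finField_card_gt0. Qed.

Lemma frobeniusD x y : (x + y) ^+ q = x ^+ q + y ^+ q.
Proof.
have N (z : L) : (- z) ^+ q = - z ^+ q by rewrite -[- z]add0r frobeniusB expr0_card sub0r.
by rewrite -{1}[y]opprK frobeniusB N opprK.
Qed.

(** X^q - X already splits over F. *)
Lemma frobenius_fixed x : x ^+ q = x -> x \in 1%VS.
Proof.
move=> xFx; apply/vlineP.
have: root (('X^q - 'X)^L) x.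
  by rewrite rmorphB /= map_polyXn map_polyX rootE !(hornerE, hornerXn) xFx subrr.
have -> : ('X^q - 'X)^L = \prod_(z <- [seq b%:A | b : F]) ('X - z%:P).
  rewrite finField_genPoly rmorph_prod big_image /=.
  by apply: eq_bigr => b _; rewrite rmorphB /= map_polyX map_polyC.
by rewrite root_prod_XsubC => /mapP[a]; exists a.
Qed.

Lemma horner_frobenius p x s : p^L.[x ^+ (q ^ s)] = p^L.[x] ^+ (q ^ s).
Proof.
elim: s x => [|s IH] x; first by rewrite !expr1.
rewrite expnSr !exprM -IH; elim/poly_ind: p {IH} => [|p c IHp].
  by rewrite rmorph0 !horner0 expr0_card.
rewrite rmorphD rmorphM /= map_polyX map_polyC !hornerMXaddC frobeniusD exprMn IHp.
by rewrite -[in_alg L c ^+ q]rmorphXn expf_card.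
Qed.

(** Galois descent: Frobenius permutes the factors, so it fixes every coefficient of the product. *)
Lemma frobenius_stable_poly (s : seq L) :
  perm_eq [seq x ^+ q | x <- s] s ->
  exists p, p^L = \prod_(x <- s) ('X - x%:P).
Proof.
move=> qs; have coefq k (r : seq L) :
    (\prod_(x <- r) ('X - x%:P))`_k ^+ q = (\prod_(x <- r) ('X - (x ^+ q)%:P))`_k.
  elim: r k => [|a r IH] k.
    by rewrite !big_nil coef1; case: (k == 0%N); rewrite ?expr1n ?expr0_card.
  rewrite !big_cons !mulrBl !coefB !coefXM !coefCM frobeniusB exprMn !IH.
  by case: (k == 0%N); rewrite ?IH ?expr0_card.
suff /polyOver1P[p ->] : \prod_(x <- s) ('X - x%:P) \is a polyOver 1%AS by exists p.
apply/polyOverP=> k; apply: frobenius_fixed.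
by rewrite coefq -[in RHS](perm_big _ qs) big_map.
Qed.

Lemma minpoly_dvd x p r : is_minpoly_over x p -> root r^L x = (p %| r).
Proof.
case=> pm px pmin; apply/idP/idP => [rx|/dvdpP[d ->]]; last first.
  by rewrite rmorphM /= rootM px orbT.
have p0 : p != 0 by apply: monic_neq0.
apply/modp_eq0P/eqP/negPn/negP => r0.
have : root (r %% p)^L x.
  move: rx; rewrite {1}(divp_eq r p) rmorphD rmorphM /= !rootE hornerD hornerM.
  by rewrite (rootP px) mulr0 add0r.
by move/(pmin _ r0); rewrite leqNgt ltn_modp p0.
Qed.

End Frobenius.

(** * Divisibility by least common multiples *)

Section LcmPoly.
Variable F : finFieldType.
Implicit Types p r d : {poly F}.

(** After division by the gcd the cofactors are coprime, and Gauss's lemma applies. *)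
Lemma lcm_poly_dvd p r d : p != 0 -> (lcm_poly p r %| d) = (p %| d) && (r %| d).
Proof.
move=> p0; rewrite /lcm_poly; set g := gcdp p r.
have g0 : g != 0 by rewrite gcdp_eq0 negb_and p0.
have [p' pE] := dvdpP _ _ (dvdp_gcdl p r); rewrite -/g in pE.
have [r' rE] := dvdpP _ _ (dvdp_gcdr p r); rewrite -/g in rE.
have p'0 : p' != 0 by apply: contraNneq p0 => p'0; rewrite pE p'0 mul0r.
have cop : coprimep r' p'.
  rewrite coprimep_sym; have := @coprimep_div_gcd _ p r.
  by rewrite p0 => /(_ isT); rewrite -/g {1}pE {1}rE !mulpK.
have -> : p * r %/ g = p * r' by rewrite rE mulrA mulpK.
apply/idP/andP => [H|[/dvdpP[e ->]]].
  split; first by apply: dvdp_trans H; rewrite dvdp_mulr.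
  by apply: dvdp_trans H; rewrite rE mulrC pE -mulrA dvdp_mull.
rewrite rE pE mulrA dvdp_mul2r // Gauss_dvdpl // => H.
have -> : e * p' * g = p' * g * e by rewrite -mulrA mulrC.
by rewrite dvdp_mul2l ?mulf_neq0.
Qed.

Lemma lcm_poly_neq0 p r : p != 0 -> r != 0 -> lcm_poly p r != 0.
Proof.
move=> p0 r0; apply: contraNneq (mulf_neq0 p0 r0) => l0.
have := @lcm_poly_dvd p r (p * r) p0.
by rewrite l0 dvd0p dvdp_mulr // dvdp_mull.
Qed.

Lemma bch_gen_dvd (mp : nat -> {poly F}) delta b d :
  (forall i, mp i != 0) ->
  (bch_gen mp delta b %| d) =
    all (fun i => mp i %| d) (index_iota b (b + delta.-1)).
Proof.
move=> mp0; rewrite /bch_gen.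
elim: (index_iota _ _) => [|i s IH]; first by rewrite big_nil dvd1p.
by rewrite big_cons lcm_poly_dvd // IH.
Qed.

Lemma bch_gen_neq0 (mp : nat -> {poly F}) delta b :
  (forall i, mp i != 0) -> bch_gen mp delta b != 0.
Proof.
move=> mp0; rewrite /bch_gen.
by elim/big_ind: _ => //; [exact: oner_neq0|exact: lcm_poly_neq0].
Qed.

End LcmPoly.

(** * Zeros, BCH bound and dimension of cyclic codes *)

Section BCHCodes.
Variables (F : finFieldType) (L : fieldExtType F) (n : nat) (beta : L).
Variables (mp : nat -> {poly F}).
Hypotheses (prim : n.-primitive_root beta)
           (minp : forall i, is_minpoly_over (beta ^+ i) (mp i)).
Local Notation q := #|F|.
Local Notation "p ^L" := (map_poly (in_alg L) p) (at level 2, format "p ^L").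

Lemma minpoly_neq0 i : mp i != 0.
Proof. by case: (minp i) => /monic_neq0. Qed.
Hint Resolve minpoly_neq0 : core.

Lemma prim_gt0 : (0 < n)%N.
Proof. exact: prim_order_gt0 prim. Qed.

Lemma mem_bch_code delta b (c : 'rV[F]_n) :
  (c \in bch_code n mp delta b) =
    all (fun i => root (rVpoly c)^L (beta ^+ i)) (index_iota b (b + delta.-1)).
Proof.
rewrite inE bch_gen_dvd //; apply: eq_all => i.
by rewrite (minpoly_dvd _ (minp i)).
Qed.

(** The product of X - beta^(i q^k) over k < M descends to F and vanishes at beta^i, so [mp i]
    divides it. Any period M will do, since repeated factors are harmless. *)
Lemma root_minpoly M i j : (0 < M)%N -> (forall x, x * q ^ M = x %[mod n])%N ->
  root (mp i)^L (beta ^+ j) = [exists s : 'I_M, i * q ^ s == j %[mod n]]%N.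
Proof.
case: M => // M _ period; apply/idP/existsP => [rj|[s /eqP ij]]; last first.
  rewrite -(prim_expr_mod prim j) -ij (prim_expr_mod prim) exprM rootE.
  rewrite horner_frobenius expf_eq0 expn_gt0 finField_card_gt0 -rootE.
  by case: (minp i).
pose s := [seq beta ^+ (i * q ^ k) | k <- iota 0 M.+1].
have stable : perm_eq [seq x ^+ q | x <- s] s.
  (* Frobenius shifts the list by one place, and the period closes the cycle. *)
  have -> : [seq x ^+ q | x <- s] = rot 1 s.
    rewrite /s -{1}[M.+1]addn1 iotaD !map_cat /= rot1_cons -cats1 -[1%N]addn0 iotaDl.
    rewrite -!map_comp add0n; congr (_ ++ _).
      by apply: eq_map => k /=; rewrite -exprM -mulnA -expnSr.
    rewrite -exprM -mulnA -expnSr muln1 -(prim_expr_mod prim).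
    by rewrite period (prim_expr_mod prim).
  by rewrite perm_rot.
have [p pE] := frobenius_stable_poly stable.
have : root p^L (beta ^+ i).
  by rewrite pE root_prod_XsubC; apply/mapP; exists 0%N; rewrite ?muln1.
rewrite (minpoly_dvd _ (minp i)) => /dvdpP[d pd].
have : root p^L (beta ^+ j) by rewrite pd rmorphM rootM rj orbT.
rewrite pE root_prod_XsubC => /mapP[k]; rewrite mem_iota /= add0n => kM /eqP.
by rewrite (eq_prim_root_expr prim) eq_sym; exists (Ordinal kM).
Qed.

Lemma minpoly_dvd_Xn_sub1 i : mp i %| 'X^n - 1.
Proof.
rewrite -(minpoly_dvd _ (minp i)) rmorphB rmorph1 /= map_polyXn.
rewrite rootE !(hornerE, hornerXn) -exprM mulnC exprM.
by rewrite (prim_expr_order prim) expr1n subrr.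
Qed.

Lemma bch_gen_dvd_Xn_sub1 delta b : bch_gen mp delta b %| 'X^n - 1.
Proof. by rewrite bch_gen_dvd //; apply/allP=> i _; apply: minpoly_dvd_Xn_sub1. Qed.

(** The lcm is a multiple of each factor and divides their product. *)
Lemma root_bch_gen delta b x :
  root (bch_gen mp delta b)^L x =
    has (fun i => root (mp i)^L x) (index_iota b (b + delta.-1)).
Proof.
set r := index_iota _ _.
have rootD (p d : {poly F}) : p %| d -> root p^L x -> root d^L x.
  by move=> /dvdpP[e ->] px; rewrite rmorphM rootM px orbT.
apply/idP/hasP => [|[i ir ix]]; last first.
  apply: rootD ix; have := dvdpp (bch_gen mp delta b).
  by rewrite {1}bch_gen_dvd // => /allP; apply.
have : bch_gen mp delta b %| \prod_(i <- r) mp i.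
  rewrite bch_gen_dvd //; apply/allP=> i ir.
  by rewrite (big_rem i) //= dvdp_mulr.
move=> /rootD H {}/H; rewrite rmorph_prod /= rootE horner_prod prodf_seq_eq0.
case/hasP=> i ir /= ix.
by exists i.
Qed.

(** The generator divides X^n - 1, whose roots are the n distinct powers of beta, so its degree is
    its number of roots among them. *)
Lemma size_bch_gen delta b :
  size (bch_gen mp delta b) =
    #|[set j : 'I_n | root (bch_gen mp delta b)^L (beta ^+ j)]|.+1.
Proof.
set g := bch_gen _ _ _.
have : g^L %| \prod_(i <- index_iota 0 n) ('X - (beta ^+ i)%:P).
  rewrite (factor_Xn_sub_1 prim) -(map_polyXn (in_alg L)).
  by rewrite -(rmorph1 (map_poly (in_alg L))) -rmorphB dvdp_map bch_gen_dvd_Xn_sub1.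
move=> /dvdp_prod_XsubC[w gw].
have gx x : root g^L x = (x \in [seq beta ^+ i | i <- mask w (index_iota 0 n)]).
  rewrite (eqp_root gw) -(big_map (fun i => beta ^+ i) predT (fun z => 'X - z%:P)).
  by rewrite root_prod_XsubC.
rewrite -(size_map_poly (in_alg L)) (eqp_size gw) size_prod_XsubC; congr _.+1.
set s := mask _ _ in gx *.
have su : uniq s by rewrite mask_uniq ?iota_uniq.
have sn i : i \in s -> (i < n)%N by move/mem_mask; rewrite mem_index_iota.
have -> : s = [seq i <- index_iota 0 n | i \in s].
  by apply: mask_filter; rewrite iota_uniq.
rewrite -sum1_card size_filter -sum1_count big_mkord; apply: eq_bigl => j.
rewrite inE gx; apply/idP/mapP => [js|[i is_ /eqP]]; first by exists (val j).
rewrite (eq_prim_root_expr prim) [(j %% n)%N]modn_small // modn_small ?sn //.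
by move/eqP->.
Qed.

Lemma horner_rVpoly_map (c : 'rV[F]_n) x :
  (rVpoly c)^L.[x] = \sum_(i < n) (c 0 i)%:A * x ^+ i.
Proof.
rewrite (@horner_coef_wide _ n) ?size_map_poly ?size_poly //.
by apply: eq_bigr => i _; rewrite coef_map coef_rVpoly_ord.
Qed.

Lemma bch_bound (c : 'rV[F]_n) D b :
  (forall l, (l < D.-1)%N -> root (rVpoly c)^L (beta ^+ (b + l))) ->
  c != 0 -> (D <= wt c)%N.
Proof.
(* If the support were too small, pairing c with the polynomial p vanishing at all
   of it but one point would isolate that coordinate of c. *)
move=> croot c0; rewrite leqNgt; apply/negP => wD.
have [i ci] : exists i, c 0 i != 0.
  apply/existsP; rewrite -negb_forall; apply: contra c0 => /forallP cz.
  by apply/eqP/rowP=> i; rewrite mxE; apply/eqP.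
pose S := [set i | c 0 i != 0] :\ i.
pose p := \prod_(j <- [seq beta ^+ (j : 'I_n) | j in S]) ('X - j%:P).
have pS : size p = #|S|.+1 by rewrite size_prod_XsubC size_image.
have SD : (size p <= D.-1)%N.
  have : wt c = #|S|.+1 by rewrite /wt (cardsD1 i) inE ci.
  by rewrite pS => <-; rewrite -ltnS (ltn_predK wD).
have E : \sum_(j < n) (c 0 j)%:A * beta ^+ (b * j) * p.[beta ^+ j] = 0.
  rewrite (eq_bigr (fun j : 'I_n =>
      \sum_(l < size p) p`_l * ((c 0 j)%:A * (beta ^+ (b + l)) ^+ j))); last first.
    move=> j _; rewrite horner_coef mulr_sumr; apply: eq_bigr => l _.
    rewrite mulrCA -!mulrA; congr (_ * (_ * _)).
    by rewrite -!exprM mulnDl exprD [(l * j)%N]mulnC.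
  rewrite exchange_big big1 // => l _; rewrite -mulr_sumr -horner_rVpoly_map.
  by rewrite (rootP (croot l (leq_trans (ltn_ord l) SD))) mulr0.
have bN0 k : beta ^+ k != 0.
  by rewrite expf_eq0 (prim_root_eq0 prim) gtn_eqF ?prim_gt0 ?andbF.
have : (c 0 i)%:A * beta ^+ (b * i) * p.[beta ^+ i] != 0.
  rewrite !mulf_neq0 ?bN0 ?scaler_eq0 ?oner_eq0 ?orbF // -rootE root_prod_XsubC.
  apply/imageP=> [[j jS /eqP]].
  rewrite (eq_prim_root_expr prim) !modn_small // => /eqP/val_inj ij.
  by move: jS; rewrite -ij !inE eqxx.
rewrite -E (bigD1 i) //= addrC big1 ?add0r ?eqxx // => j ji.
have [cj|cj] := eqVneq (c 0 j) 0; first by rewrite cj scale0r !mul0r.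
suff /rootP -> : root p (beta ^+ j) by rewrite mulr0.
by rewrite root_prod_XsubC image_f // !inE ji.
Qed.

(** Multiplication by g maps the polynomials of degree below n - deg g isomorphically onto the
    code. *)
Lemma cyclic_code_dim (g : {poly F}) : g != 0 -> (size g <= n.+1)%N ->
  code_dim (cyclic_code n g) = (n - (size g).-1)%N.
Proof.
move=> g0 gn; set k := (n - (size g).-1)%N.
have sg : (0 < size g)%N by rewrite size_poly_gt0.
have size_mul_g (u : {poly F}) : (size u <= k)%N = (size (u * g)%R <= n)%N.
  have [->|u0] := eqVneq u 0; first by rewrite mul0r size_poly0.
  rewrite size_mul // -(prednK sg) addnS /= leq_subRL ?leq_pred //.
    by rewrite addnC.
  by rewrite -ltnS (prednK sg).
pose f (u : 'rV[F]_k) : 'rV[F]_n := poly_rV (rVpoly u * g).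
have fK u : rVpoly (f u) = rVpoly u * g by rewrite poly_rV_K // -size_mul_g size_poly.
have f_lin : linear f.
  by move=> a u v; rewrite /f linearP mulrDl -scalerAl linearP.
pose fl : {linear 'rV[F]_k -> 'rV[F]_n} :=
  HB.pack f (GRing.isLinear.Build _ _ _ _ f f_lin).
have flE u : linfun fl u = f u by rewrite lfunE.
rewrite /code_dim; suff -> : span (enum (cyclic_code n g)) = limg (linfun fl).
  have ker0 : lker (linfun fl) == 0%VS.
    apply/lker0P=> u v; rewrite !flE => /(congr1 rVpoly); rewrite !fK.
    by move/(mulIf g0)/(can_inj rVpolyK).
  by rewrite limg_dim_eq ?(eqP ker0) ?capv0 // dimvf /dim /= mul1n.
apply/eqP; rewrite eqEsubv; apply/andP; split.
  apply/span_subvP=> c; rewrite mem_enum inE => /dvdpP[u cu].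
  have uk : (size u <= k)%N by rewrite size_mul_g -cu size_poly.
  apply/memv_imgP; exists (poly_rV u); rewrite ?memvf // flE.
  by apply: (can_inj rVpolyK); rewrite fK poly_rV_K.
apply/subvP=> _ /memv_imgP[u _ ->]; apply: memv_span.
by rewrite mem_enum inE flE fK dvdp_mull.
Qed.

Lemma bch_code_dim delta b :
  code_dim (bch_code n mp delta b) =
    (n - #|[set j : 'I_n | root (bch_gen mp delta b)^L (beta ^+ j)]|)%N.
Proof.
rewrite cyclic_code_dim ?bch_gen_neq0 // size_bch_gen //.
by rewrite ltnS -[X in (_ <= X)%N]card_ord max_card.
Qed.

End BCHCodes.

(** * Negation-stable zeros and the LCD property *)

Lemma symmetric_code_LCD (F : finFieldType) (L : fieldExtType F) (n : nat)
    (beta : L) (C : {set 'rV[F]_n}) (zeros : seq nat) :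
  n.-primitive_root beta ->
  (forall c, (c \in C) =
     all (fun k => root (map_poly (in_alg L) (rVpoly c)) (beta ^+ k)) zeros) ->
  (forall c k, c \in C -> k \in zeros ->
     root (map_poly (in_alg L) (rVpoly c)) (beta ^- k)) ->
  is_LCD C.
Proof.
(* For n a successor, 'I_n carries addition modulo n, so [s - i] below is a cyclic shift. *)
case: n C => [|n'] C prim memC symC; first by have := prim_order_gt0 prim.
set n := n'.+1 in C prim memC symC *.
pose e (i : 'I_n) := beta ^+ i.
have eD i j : e (i + j) = e i * e j by rewrite /e /= (prim_expr_mod prim) exprD.
have eX i (k : 'I_n) : e k ^+ i = (beta ^+ i) ^+ k by rewrite -!exprM mulnC.
have evE (c : 'rV[F]_n) k : (map_poly (in_alg L) (rVpoly c)).[beta ^+ k] =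
    \sum_(i < n) (c 0 i)%:A * e i ^+ k.
  by rewrite horner_rVpoly_map; apply: eq_bigr => i _; rewrite eX.
apply/setP=> c; rewrite inE [c \in [set 0]]inE; apply/andP/eqP => [[cC]|->]; last first.
  split; last by rewrite inE; apply/forall_inP=> d _; rewrite mul0mx.
  by rewrite memC; apply/allP=> i _; rewrite linear0 rmorph0 root0.
rewrite inE => /forall_inP cdual.
(* The reversed shifts of c lie in C, so orthogonality says that c * c = 0. *)
pose d (s : 'I_n) : 'rV[F]_n := \row_i c 0 (s - i).
have dC s : d s \in C.
  rewrite memC; apply/allP=> k Pk; rewrite rootE evE.
  (* Substituting s - i for i turns the value of [d s] at beta^k into beta^(s k) c(beta^-k). *)
  rewrite (reindex_inj (inv_inj (subKr s))) /=.
  rewrite (eq_bigr (fun i : 'I_n => e s ^+ k * ((c 0 i)%:A * (beta ^- k) ^+ i))).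
    rewrite -mulr_sumr -horner_rVpoly_map.
    by rewrite (rootP (symC c k cC Pk)) mulr0.
  move=> i _; rewrite mxE subKr mulrCA; congr (_ * _).
  rewrite exprVn -(eX k i) -exprVn -exprMn; congr (_ ^+ _).
  have e0 : e i != 0 by rewrite /e expf_eq0 (prim_root_eq0 prim) andbF.
  by apply: (mulIf e0); rewrite -eD subrK mulfVK.
have conv s : \sum_(i < n) c 0 i * c 0 (s - i) = 0.
  have /eqP/rowP/(_ 0) := cdual _ (dC s); rewrite !mxE.
  by apply: etrans; apply: eq_bigr => i _; rewrite !mxE.
(* Evaluation turns convolution into a product, so c(beta^k)^2 = 0. *)
have cz k : (map_poly (in_alg L) (rVpoly c)).[beta ^+ k] = 0.
  apply/eqP; rewrite -[_ == 0]orbb -mulf_eq0 evE mulr_suml; apply/eqP.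
  rewrite (eq_bigr (fun i : 'I_n =>
      \sum_(s < n) e s ^+ k * in_alg L (c 0 i * c 0 (s - i)))); last first.
    move=> i _; rewrite mulr_sumr (reindex_inj (can_inj (subrK i))) /=.
    apply: eq_bigr => s _.
    rewrite mulrACA -exprMn -eD [i + _]addrC subrK mulrC; congr (_ * _).
    by rewrite -!in_algE -rmorphM.
  rewrite exchange_big big1 // => s _.
  by rewrite -mulr_sumr -rmorph_sum conv rmorph0 mulr0.
(* A polynomial of degree below n with n distinct roots is zero. *)
apply/eqP; rewrite -(inj_eq (can_inj rVpolyK)) linear0.
rewrite -(map_poly_eq0 (in_alg L)); apply/eqP.
apply: (@roots_geq_poly_eq0 _ _ [seq beta ^+ (i : 'I_n) | i : 'I_n]).
- by apply/allP=> _ /imageP[i _ ->]; apply/rootP.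
- rewrite map_inj_uniq ?enum_uniq // => i j /eqP.
  by rewrite (eq_prim_root_expr prim) !modn_small // => /eqP/val_inj.
- by rewrite size_map_poly size_image card_ord size_poly.
Qed.

(** * BCH codes whose length divides q^s + 1 *)

Section NegationStableBCH.
Variables (F : finFieldType) (L : fieldExtType F) (n s : nat) (beta : L).
Variables (mp : nat -> {poly F}).
Hypotheses (prim : n.-primitive_root beta)
           (minp : forall i, is_minpoly_over (beta ^+ i) (mp i))
           (n_dvd : (n %| #|F| ^ s + 1)%N).
Local Notation "p ^L" := (map_poly (in_alg L) p) (at level 2, format "p ^L").

(** As q^s = -1 modulo n, beta^-k is a Frobenius conjugate of beta^k. *)
Lemma root_expN p k : root p^L (beta ^+ k) -> root p^L (beta ^- k).
Proof.
have b0 : beta ^+ k != 0.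
  by rewrite expf_eq0 (prim_root_eq0 prim) gtn_eqF ?(prim_gt0 prim) ?andbF.
have -> : beta ^- k = (beta ^+ k) ^+ (#|F| ^ s).
  apply: (mulIf b0); rewrite mulVf // -exprSr -exprM -addn1; apply/esym/eqP.
  by rewrite -(prim_order_dvd prim) dvdn_mull.
rewrite !rootE horner_frobenius => /eqP ->.
by rewrite expf_eq0 eqxx expn_gt0 finField_card_gt0.
Qed.

Lemma bch_code_LCD delta b : is_LCD (bch_code n mp delta b).
Proof.
apply: (symmetric_code_LCD prim (mem_bch_code minp delta b)) => c k.
by rewrite (mem_bch_code minp) => /allP cz /cz /root_expN.
Qed.

Lemma bch_code_min_dist delta b : min_dist_ge (bch_code n mp delta b) delta.
Proof.
move=> c; rewrite (mem_bch_code minp) => /allP cz.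
apply: (bch_bound prim (b := b)) => l ld.
by apply: cz; rewrite mem_index_iota leq_addr ltn_add2l.
Qed.

Lemma bch_code0_min_dist delta : (0 < delta <= n)%N ->
  min_dist_ge (bch_code n mp delta.+1 0) delta.*2.
Proof.
case/andP=> d0 dn c; rewrite (mem_bch_code minp) => /allP cz.
have {}cz k : (k < delta)%N -> root (rVpoly c)^L (beta ^+ k).
  by move=> kd; apply: cz; rewrite mem_index_iota.
(* The starting exponent stands for -(delta-1); from l = delta-1 on the exponents wrap around to 0,
   1, .... *)
apply: (bch_bound prim (b := (n - delta.-1)%N)) => l ld.
have [ld1|dl] := ltnP l delta.-1; last first.
  have -> : (n - delta.-1 + l = n + (l - delta.-1))%N.
    by rewrite addnBA // addnBAC // (leq_trans (leq_pred _)).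
  rewrite exprD (prim_expr_order prim) mul1r; apply: cz.
  rewrite ltn_subLR //; move: ld; rewrite -addnn.
  by case: (delta) d0 => // d _; rewrite addnS addSn /= ltnS addnS ltnS addnC.
have -> : beta ^+ (n - delta.-1 + l) = beta ^- (delta.-1 - l).
  have b0 : beta ^+ (delta.-1 - l) != 0.
    by rewrite expf_eq0 (prim_root_eq0 prim) gtn_eqF ?(prim_gt0 prim) ?andbF.
  apply: (mulIf b0); rewrite mulVf // -exprD -addnA subnKC; last exact: ltnW.
  by rewrite subnK ?(prim_expr_order prim) // (leq_trans (leq_pred _)).
apply: root_expN; apply: cz.
by rewrite (leq_ltn_trans (leq_subr _ _)) // ltn_predL.
Qed.

End NegationStableBCH.

(** * Parameters of the two codes *)

Theorem theorem7 (F : finFieldType) (L : fieldExtType F) (q t : nat)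
  (beta : L) (mp : nat -> {poly F}) (delta : nat) :
  #|F| = q -> odd q -> (5 <= q)%N -> (2 <= t)%N ->
  (len_n q t).-primitive_root beta ->
  (forall i, is_minpoly_over (beta ^+ i) (mp i)) ->
  let m := t.*2.+1 in
  let n := len_n q t in
  let e := eps q delta in
  let C1 := bch_code n mp delta 1 in
  let C0 := bch_code n mp delta.+1 0 in
  forall k : nat,
  (((q ^ t + 2 <= delta)%N && (delta <= boundA q t)%N /\ k = (n - 2 * m * (e - 1))%N)
   \/ ((boundA q t + 1 <= delta)%N && (delta <= boundB q t)%N
       /\ k = (n - 2 * m * (e - 2))%N)) ->
  [/\ is_LCD C1, code_dim C1 = k & min_dist_ge C1 delta] /\
  [/\ is_LCD C0, code_dim C0 = k.-1 & min_dist_ge C0 delta.*2].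
Proof.
move=> qF q_odd q5 t2 prim minp m n e C1 C0 k hk; subst q.
have [nqE [u [v [suv AE BE]]]] := bch_split_exists q5 t2.
have nq : (n %| #|F| ^ m + 1)%N by rewrite -nqE dvdn_mulr.
have [v0 Q cs] := suv.
have q5v := le_5v_qv v q5.
have vu : (5 * v <= u + 1)%N by clear -cs q5v; lia.
(* In the first range delta <= A = u + 2v, which is below 2u because 5v <= u + 1. *)
have [du d2] : (u < delta /\ delta < 2 * u)%N by clear -hk AE BE Q vu v0; lia.
have d0 : (0 < delta)%N by apply: leq_ltn_trans du.
have dn : (delta <= n)%N.
  have := @range_sum_lt #|F| t n u v q5 t2 suv delta.-1 0.
  by rewrite addn0 prednK //; apply; clear -d2 d0; lia.
pose M := m.*2.
pose Z := @cyclotomic_closure #|F| t n delta.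
have cardZ : #|Z| = (M * (eps #|F| delta - 1 - (u + 2 * v < delta)))%N.
  by rewrite (card_cyclotomic_closure q5 t2 suv nq du d2) (card_leaders q5 t2 suv du).
have rootE i (j : 'I_n) := root_minpoly prim minp i j (isT : 0 < M)%N (pow_period nq).
have dim1 : code_dim C1 = (n - #|Z|)%N.
  rewrite (bch_code_dim prim minp); congr (_ - _)%N; apply: eq_card => j.
  rewrite !inE (root_bch_gen minp); apply/hasP/existsP => [[i]|[i /andP[i0 ij]]].
    rewrite mem_index_iota add1n prednK // rootE => /andP[i0 id] ij.
    by exists (Ordinal id); rewrite /= i0.
  by exists (val i); rewrite ?rootE // mem_index_iota add1n prednK // i0 ltn_ord.
have dim0 : code_dim C0 = (n - #|Z|).-1.
  (* The zeros of [C0] have exponents in [Z] together with 0. *)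
  pose j0 : 'I_n := Ordinal (leq_trans d0 dn).
  have Z0 : j0 \notin Z by apply: (zero_notin_closure q5 t2 suv nq d2).
  rewrite (bch_code_dim prim minp) -subnS -[(#|Z|).+1]/(1 + #|Z|)%N.
  have -> : (1 + #|Z| = #|j0 |: Z|)%N by rewrite cardsU1 Z0.
  congr (_ - _)%N; apply: eq_card => j.
  rewrite !inE (root_bch_gen minp) add0n /index_iota subn0.
  rewrite /= -[delta in iota 0 delta](prednK d0) /= rootE; congr (_ || _).
    rewrite -val_eqE /=.
    apply/existsP/eqP => [[s]|->]; last by exists ord0.
    by rewrite mul0n eq_sym mod0n modn_small // => /eqP.
  apply/hasP/existsP => [[i]|[i /andP[i0 ij]]].
    rewrite mem_iota add1n prednK // rootE => /andP[i0 id] ij.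
    by exists (Ordinal id); rewrite /= i0.
  by exists (val i); rewrite ?rootE // mem_iota add1n prednK // i0 ltn_ord.
have -> : k = (n - #|Z|)%N.
  rewrite cardZ /M -mul2n; case: hk => [[/andP[_ dA] ->]|[/andP[Ad _] ->]].
    by rewrite ltnNge -AE dA subn0.
  by rewrite addn1 in Ad; rewrite -AE Ad -subnDA.
split; split=> //; try exact: (bch_code_LCD prim minp nq).
  exact: (bch_code_min_dist prim minp).
by apply: (bch_code0_min_dist prim minp nq); rewrite dn andbT.
Qed.
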